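(* If $\{a_1 \pmod{m_1}, \ldots, a_n \pmod{m_n}\}$ is a covering system with distinct moduli (i.e. $m_i \neq m_j$ whenever $i \neq j$) whose smallest modulus is $\min_i m_i = 5$, then the least common multiple of the moduli satisfies $\operatorname{lcm}(m_1, \ldots, m_n) \geq 1440$.
   Context: For an integer $a$ and a positive integer $m$, the arithmetic progression $a \pmod{m}$ is the set $\{a+km : k \in \mathbb{Z}\}$, and $m$ is called its modulus. A covering system is a finite set of arithmetic progressions $\{a_1 \pmod{m_1}, \ldots, a_n \pmod{m_n}\}$ such that every integer belongs to at least one of them. *)

(* Defs.v *)
From mathcomp Require Import all_boot all_algebra.

Set Implicit Arguments.
Unset Strict Implicit.
Unset Printing Implicit Defensive.

Definition progression (a : int) (m : nat) (x : int) : Prop :=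
  exists k : int, x = (a + k * m%:Z)%R.

(* A finite collection of progressions is given by its residues and moduli,
   indexed by 'I_n.  Repeated progressions are not excluded here; they are
   excluded whenever the moduli are distinct. *)
Definition covering_system (n : nat) (a : 'I_n -> int) (m : 'I_n -> nat) : Prop :=
  (forall i : 'I_n, 0 < m i) /\
  (forall x : int, exists i : 'I_n, progression (a i) (m i) x).

(* Main.v *)
(* The least common multiple N of the moduli is a multiple of 5, and the density
   bound 1 <= sum of 1/d over the divisors d >= 5 of N leaves, below 1440, only
   divisors of ten values of N.  Write such a value as N = M p q with M, p, q
   pairwise coprime and put over each u in Z/M the p x q grid of residues modulo
   p and q.  A progression of modulus d removes, above one residue class modulo
   e = gcd(d, M), the whole grid, a column, a row or a point, according to which
   of p and q divide d.  If we only remember how many columns and rows are left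
   and how many points were removed, then all columns (rows) become
   interchangeable, and a short search over the residue classes modulo e closes
   every case: a branch dies when the remaining progressions, each placed where
   it removes most, cannot remove all the cells that are left. *)
Require Import Defs.
From mathcomp Require Import all_boot all_algebra.
From mathcomp Require Import zify.

Set Implicit Arguments.
Unset Strict Implicit.
Unset Printing Implicit Defensive.

(** * Grids over residue classes, strikes and the counting bound *)

(** Taking [r] as a function of [d] encodes distinct moduli: each [d] gets a single class. All
    divisors from 5 on may be used, so the property passes to multiples of [N]. *)
Definition covered (N : nat) : Prop :=
  exists r : nat -> nat, forall x : nat,
    exists d : nat, [/\ d %| N, 5 <= d & x = r d %[mod d]].

(* (a, b, c): at least a columns and b rows are left, and at most c points have
   been removed from their intersection. *)
Definition cell : Type := nat * nat * nat.

(* What a progression of modulus d removes from a grid; the booleans tell whether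
   p, respectively q, divides d. *)
Definition part : Type := bool * bool.

Definition hit (k : part) (x : cell) : cell :=
  let: (a, b, c) := x in
  match k with
  | (false, false) => (0, b, c)
  | (true, false) => (a.-1, b, c)
  | (false, true) => (a, b.-1, c)
  | (true, true) => (a, b, c.+1)
  end.

Definition deficit (x : cell) : nat := let: (a, b, c) := x in a * b - c.

(** An upper bound for the drop of [deficit] under [hit k]. The lengths [a] and [b] ignore removed
    points; the minimum with the deficit partly makes up for this. *)
Definition gain (k : part) (x : cell) : nat :=
  let: (a, b, c) := x in
  match k with
  | (false, false) => deficit x
  | (true, false) => minn b (deficit x)
  | (false, true) => minn a (deficit x)
  | (true, true) => minn 1 (deficit x)
  end.

Definition strike (e : nat) (k : part) (r : nat) (g : nat -> cell) (u : nat) :=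
  if u == r %[mod e] then hit k (g u) else g u.

Fixpoint solvable (L : seq (nat * part)) (g : nat -> cell) : Prop :=
  if L is (e, k) :: L' then exists r, solvable L' (strike e k r g)
  else forall u, deficit (g u) = 0.

Definition cap_at (M : nat) (g : nat -> cell) (x : nat * part * nat) : Prop :=
  forall r, \sum_(u < M | u == r %[mod x.1.1]) gain x.1.2 (g u) <= x.2.

Lemma deficit_hit (k : part) (x : cell) :
  deficit x <= deficit (hit k x) + gain k x.
Proof. case: x k => [[a b] c] [[] []] /=; nia. Qed.

Lemma gain_hit (k k' : part) (x : cell) : gain k (hit k' x) <= gain k x.
Proof. case: x k k' => [[a b] c] [[] []] [[] []] /=; nia. Qed.

Lemma solvable_ext (L : seq (nat * part)) (g h : nat -> cell) :
  g =1 h -> solvable L g -> solvable L h.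
Proof.
elim: L g h => [|[e k] L IHL] g h gh /=; first by move=> g0 u; rewrite -gh.
by case=> r; exists r; apply: IHL p => u; rewrite /strike gh.
Qed.

Lemma solvable_shift (L : seq (nat * part)) (g : nat -> cell) (t : nat) :
  all (fun x => 0 < x.1) L -> solvable L g -> solvable L (fun u => g (u + t)).
Proof.
elim: L g => [|[e k] L IHL] g /=; first by move=> _ g0 u.
case/andP=> e_gt0 L_gt0 [r /(IHL _ L_gt0) solL].
(* [t * e.-1] plays the role of [- t] modulo [e] and keeps the residue a natural number. *)
exists (r + t * e.-1); apply: solvable_ext solL => u; rewrite /strike.
rewrite -(eqn_modDr t u) -addnA -mulnSr prednK //.
by rewrite [r + _]addnC modnMDl.
Qed.

(** A constant grid is invariant under translation, so everything can be shifted by the common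
    solution of the two chosen residues. *)
Lemma solvable_normalize (e1 e2 : nat) (k1 k2 : part) (L : seq (nat * part))
    (x : cell) :
  coprime e1 e2 -> all (fun y => 0 < y.1) [:: (e1, k1), (e2, k2) & L] ->
  solvable [:: (e1, k1), (e2, k2) & L] (fun=> x) ->
  solvable L (strike e2 k2 0 (strike e1 k1 0 (fun=> x))).
Proof.
move=> co12 /= /and3P[_ _ L_gt0] [r1 [r2]].
move/(solvable_shift (chinese e1 e2 r1 r2) L_gt0).
apply: solvable_ext => u; rewrite /strike.
set t := chinese _ _ _ _.
have shift e r : t = r %[mod e] -> (u + t == r %[mod e]) = (u == 0 %[mod e]).
  by move=> <-; rewrite -{2}[t]add0n eqn_modDr.
by rewrite !shift // ?chinese_modl ?chinese_modr.
Qed.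

(** Each strike lowers the total deficit by at most its cap, and by [gain_hit] the caps of the later
    strikes survive it. *)
Lemma deficit_bound (M : nat) (L : seq (nat * part * nat)) (g : nat -> cell) :
  solvable (unzip1 L) g -> {in L, forall x, cap_at M g x} ->
  \sum_(u < M) deficit (g u) <= sumn (unzip2 L).
Proof.
elim: L g => [|[[e k] m] L IHL] g /=.
  by move=> g0 _; rewrite big1 // => u _; apply: g0.
case=> r solL capL.
have := capL _ (mem_head _ _) r => /= le_m.
have {}IHL := IHL _ solL; rewrite addnC.
apply: leq_trans (leq_add (IHL _) le_m); last first.
  move=> x Lx r'; apply: leq_trans (capL x _ r'); last by rewrite inE Lx orbT.
  by apply: leq_sum => u _; rewrite /strike; case: ifP => // _; apply: gain_hit.
rewrite [X in _ + X]big_mkcond -big_split /=; apply: leq_sum => u _.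
by rewrite /strike; case: ifP => _; rewrite ?addn0 ?deficit_hit.
Qed.

(** * Executable search on periodic lists of cells *)

Definition periodic (s : seq cell) (u : nat) : cell :=
  nth (0, 0, 0) s (u %% size s).

(* j counts down to the next position of the residue class that is struck. *)
Fixpoint strikes (e : nat) (k : part) (j : nat) (s : seq cell) : seq cell :=
  if s is x :: s' then
    if j is j'.+1 then x :: strikes e k j' s' else hit k x :: strikes e k e.-1 s'
  else [::].

Fixpoint addv (v w : seq nat) : seq nat :=
  match v, w with
  | x :: v', y :: w' => x + y :: addv v' w'
  | [::], _ => w
  | _, [::] => v
  end.

Fixpoint class_sums (n e : nat) (w : seq nat) : seq nat :=
  if n is n'.+1 then addv (take e w) (class_sums n' e (drop e w)) else [::].

Definition max_class (e : nat) (w : seq nat) : nat :=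
  foldr maxn 0 (class_sums (size w %/ e) e w).

(** The four gain lists are bound outside the map so that one evaluation serves all progressions. *)
Definition refresh (s : seq cell) (L : seq (nat * part * nat)) :=
  let w00 := map (gain (false, false)) s in
  let w10 := map (gain (true, false)) s in
  let w01 := map (gain (false, true)) s in
  let w11 := map (gain (true, true)) s in
  [seq (x.1, max_class x.1.1 match x.1.2 with
    | (false, false) => w00
    | (true, false) => w10
    | (false, true) => w01
    | (true, true) => w11
    end) | x <- L].

(* The first test uses the bounds inherited from the parent node, which remain
   valid because gains only decrease; it spares most of the recomputations. *)
Fixpoint refute (n : nat) (L : seq (nat * part * nat)) (s : seq cell) : bool :=
  let t := sumn (map deficit s) in
  if sumn (unzip2 L) < t then true else
  let L' := refresh s L in
  if sumn (unzip2 L') < t then true else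
  match n, L' with
  | n'.+1, x :: L'' =>
    all (fun r => refute n' L'' (strikes x.1.1 x.1.2 r s)) (iota 0 x.1.1)
  | _, _ => false
  end.

Lemma size_strikes (e : nat) (k : part) (j : nat) (s : seq cell) :
  size (strikes e k j s) = size s.
Proof. by elim: s j => //= x s IHs [|j] /=; rewrite IHs. Qed.

Lemma nth_strikes (x0 : cell) (e : nat) (k : part) (j : nat) (s : seq cell) (i : nat) :
  j < e -> i < size s ->
  nth x0 (strikes e k j s) i =
    if i == j %[mod e] then hit k (nth x0 s i) else nth x0 s i.
Proof.
elim: s j i => //= x s IHs [|j] [|i] lt_je lt_is /=.
- by rewrite eqxx.
- rewrite IHs ?prednK //; congr (if _ then _ else _).
  (* After a hit the countdown restarts at [e.-1]: position [i.+1] is 0 modulo [e] exactly when [i]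
     is [e.-1]. *)
  by rewrite -(eqn_modDr 1) !addn1 prednK // modnn mod0n.
- by rewrite mod0n modn_small.
- by rewrite IHs ?(ltnW lt_je) // -(eqn_modDr 1) !addn1.
Qed.

Lemma periodic_strikes (e : nat) (k : part) (j : nat) (s : seq cell) :
  j < e -> e %| size s -> 0 < size s ->
  periodic (strikes e k j s) =1 strike e k j (periodic s).
Proof.
move=> lt_je e_s s_gt0 u; rewrite /periodic /strike size_strikes.
by rewrite nth_strikes ?ltn_pmod // modn_dvdm.
Qed.

Lemma nth_addv (v w : seq nat) (i : nat) :
  nth 0 (addv v w) i = nth 0 v i + nth 0 w i.
Proof. by elim: v w i => [|x v IHv] [|y w] [|i] //=; rewrite ?nth_nil ?addn0. Qed.

Lemma sum_class_recl (n e r : nat) (F : nat -> nat) :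
  r < e ->
  \sum_(0 <= i < n.+1 * e | i %% e == r) F i =
    F r + \sum_(0 <= i < n * e | i %% e == r) F (e + i).
Proof.
move=> lt_re; rewrite mulSn (big_cat_nat (n := e)) //= ?leq_addr //.
congr (_ + _).
  by rewrite big_mkord (big_pred1 (Ordinal lt_re)) // => i; rewrite /= modn_small.
rewrite -[X in index_iota X _]add0n big_addn addKn.
by apply: eq_big => i; rewrite ?modnDr // addnC.
Qed.

Lemma nth_class_sums (n e : nat) (w : seq nat) (r : nat) :
  r < e ->
  nth 0 (class_sums n e w) r = \sum_(0 <= i < n * e | i %% e == r) nth 0 w i.
Proof.
move=> lt_re; elim: n w => [|n IHn] w /=; first by rewrite nth_nil big_geq.
rewrite nth_addv IHn sum_class_recl // nth_take //; congr (_ + _).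
by apply: eq_bigr => i _; rewrite nth_drop.
Qed.

Lemma max_class_ge (e : nat) (w : seq nat) (r : nat) :
  0 < e -> e %| size w ->
  \sum_(i < size w | i == r %[mod e]) nth 0 w i <= max_class e w.
Proof.
move=> e_gt0 e_w; have lt_re : r %% e < e by rewrite ltn_pmod.
have -> : \sum_(i < size w | i == r %[mod e]) nth 0 w i =
    nth 0 (class_sums (size w %/ e) e w) (r %% e).
  by rewrite nth_class_sums // divnK // big_mkord.
rewrite /max_class; elim: (class_sums _ _ _) (r %% e) => [|x v IHv] [|i] //=.
  by rewrite leq_maxl.
by rewrite (leq_trans (IHv i)) ?leq_maxr.
Qed.

Lemma refreshE (s : seq cell) (L : seq (nat * part * nat)) :
  refresh s L = [seq (x.1, max_class x.1.1 (map (gain x.1.2) s)) | x <- L].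
Proof. by apply: eq_map => -[[e [[] []]] m]. Qed.

Lemma unzip1_refresh (s : seq cell) (L : seq (nat * part * nat)) :
  unzip1 (refresh s L) = unzip1 L.
Proof. by rewrite refreshE /unzip1 -map_comp. Qed.

Lemma refresh_cap (s : seq cell) (L : seq (nat * part * nat)) :
  {in L, forall x, 0 < x.1.1 /\ x.1.1 %| size s} ->
  {in refresh s L, forall x, cap_at (size s) (periodic s) x}.
Proof.
move=> dvdL y; rewrite refreshE => /mapP[[[e k] m] /dvdL[/= e_gt0 e_s] ->] r /=.
rewrite -(size_map (gain k)) in e_s *.
apply: leq_trans (max_class_ge r e_gt0 e_s); rewrite !size_map.
apply: leq_sum => u _; rewrite (nth_map (0, 0, 0)) ?size_map //.
by rewrite /periodic modn_small.
Qed.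

(** A strike depends on its residue only modulo [e], so trying the residues below [e] is
    exhaustive. *)
Lemma refuteP (n : nat) (L : seq (nat * part * nat)) (s : seq cell) :
  0 < size s -> {in L, forall x, 0 < x.1.1 /\ x.1.1 %| size s} ->
  {in L, forall x, cap_at (size s) (periodic s) x} ->
  refute n L s -> ~ solvable (unzip1 L) (periodic s).
Proof.
elim: n L s => [|n IHn] L s s_gt0 dvdL capL /= + solL.
all: have total : sumn (map deficit s) = \sum_(u < size s) deficit (periodic s u)
  by rewrite sumnE big_map (big_nth (0, 0, 0)) big_mkord;
     apply: eq_bigr => u _; rewrite /periodic modn_small.
(* Both early exits contradict [deficit_bound], first with the inherited caps, then with the
   refreshed ones. *)
all: rewrite total ltnNge deficit_bound //= ltnNge deficit_bound ?unzip1_refresh //=.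
all: try exact: refresh_cap.
case defL: (refresh s L) => [|[[e k] m] L'] //= /allP ref.
have capL' := refresh_cap dvdL.
have {}dvdL : {in refresh s L, forall x, 0 < x.1.1 /\ x.1.1 %| size s}.
  by move=> y; rewrite refreshE => /mapP[x /dvdL dvdx ->].
rewrite -(unzip1_refresh s) defL in solL capL' dvdL.
case: solL => r solL; have [/= e_gt0 e_s] := dvdL _ (mem_head _ _).
have lt_re : r %% e < e by rewrite ltn_pmod.
have strikeE : strike e k r (periodic s) =1 periodic (strikes e k (r %% e) s).
  by move=> u; rewrite periodic_strikes // /strike modn_mod.
apply: (IHn L' (strikes e k (r %% e) s)) (solvable_ext strikeE solL).
- by rewrite size_strikes.
- by move=> x L'x; rewrite size_strikes; apply: dvdL; rewrite inE L'x orbT.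
- move=> x L'x r'; rewrite size_strikes.
  apply: leq_trans (capL' x _ r'); last by rewrite inE L'x orbT.
  apply: leq_sum => u _; rewrite -strikeE /strike.
  by case: ifP => // _; apply: gain_hit.
- by apply: ref; rewrite mem_iota.
Qed.

(** * Soundness of cells as summaries of uncovered sets *)

(** [S] is the set still uncovered in one grid; the condition forces [deficit x] to be a lower bound
    for its size. *)
Definition fits (p q : nat) (x : cell) (S : {set 'I_p * 'I_q}) : Prop :=
  exists (A : {set 'I_p}) (B : {set 'I_q}) (P : {set 'I_p * 'I_q}),
    [/\ x.1.1 <= #|A|, x.1.2 <= #|B|, #|P| <= x.2 & setX A B :\: P \subset S].

Lemma fits_deficit (p q : nat) (x : cell) :
  fits x (set0 : {set 'I_p * 'I_q}) -> deficit x = 0.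
Proof.
case: x => [[a b] c] [A [B [P [/= leA leB leP]]]].
rewrite subset0 setD_eq0 => /subset_leq_card; rewrite cardsX => leAB.
by apply/eqP; rewrite subn_eq0 (leq_trans (leq_mul leA leB)) ?(leq_trans leAB).
Qed.

Lemma fits_hit (p q : nat) (k : part) (x : cell) (S : {set 'I_p * 'I_q})
    (i : 'I_p) (j : 'I_q) :
  fits x S ->
  fits (hit k x) [set z in S | ~~ ((k.1 ==> (z.1 == i)) && (k.2 ==> (z.2 == j)))].
Proof.
(* The struck line may already be missing from [A]; the bound [m.-1] holds either way. *)
have predD1 n (m : nat) (A : {set 'I_n}) (y : 'I_n) : m <= #|A| -> m.-1 <= #|A :\ y|.
  by rewrite (cardsD1 y A); case: (y \in A); rewrite ?add1n ?add0n;
    [case: m | apply: leq_trans; apply: leq_pred].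
case: x => [[a b] c] [A [B [P [/= leA leB leP sub]]]].
have sub' z : z.1 \in A -> z.2 \in B -> z \notin P -> z \in S.
  by move=> Az Bz Pz; apply: (subsetP sub); rewrite !inE Az Bz Pz.
case: k => [[] []] /=.
- exists A, B, ((i, j) |: P); split=> //=.
    by rewrite cardsU1 (leq_trans (leq_add (leq_b1 _) leP)).
  apply/subsetP=> -[z1 z2]; rewrite !inE negb_or xpair_eqE /=.
  by case/andP=> /andP[-> Pz] /andP[Az Bz]; rewrite sub'.
- exists (A :\ i), B, P; split=> //=; first exact: predD1.
  apply/subsetP=> -[z1 z2]; rewrite !inE andbT /=.
  by case/andP=> Pz /andP[/andP[-> Az] Bz]; rewrite sub'.
- exists A, (B :\ j), P; split=> //=; first exact: predD1.
  apply/subsetP=> -[z1 z2]; rewrite !inE /=.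
  by case/and3P=> Pz Az /andP[-> Bz]; rewrite sub'.
- exists set0, B, P; split=> //=.
  by apply/subsetP=> -[z1 z2]; rewrite !inE /= andbF.
Qed.

(** If [q = 1], its flag is always true: a whole grid is removed as its only row, a column as its
    only point. *)
Definition entry (M p q d : nat) : nat * part := (gcdn d M, (p %| d, q %| d)).

(** The true residues [r d] solve the abstract problem: what [d] covers lies above the class of
    [r d] modulo [gcdn d M], in column [r d %% p] if [p] divides [d], and likewise for rows. *)
Lemma solvable_fits (M p q : nat) (r : nat -> nat)
    (pt : nat -> 'I_p * 'I_q -> nat) (ds : seq nat) (g : nat -> cell)
    (S : nat -> {set 'I_p * 'I_q}) :
  0 < p -> 0 < q ->
  (forall u z, [/\ pt u z = u %[mod M], pt u z = z.1 %[mod p] & pt u z = z.2 %[mod q]]) ->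
  (forall u, fits (g u) (S u)) ->
  (forall u z, z \in S u -> exists2 d, d \in ds & pt u z = r d %[mod d]) ->
  solvable (map (entry M p q) ds) g.
Proof.
move=> p_gt0 q_gt0 ptE; elim: ds g S => [|d ds IHds] g S fitS covS.
  move=> u; apply: (@fits_deficit p q); suff <- : S u = set0 by [].
  by apply/setP=> z; rewrite inE; apply/negP=> /covS[].
pose i := Ordinal (ltn_pmod (r d) p_gt0); pose j := Ordinal (ltn_pmod (r d) q_gt0).
pose T u := if u == r d %[mod gcdn d M]
  then [set z in S u | ~~ (((p %| d) ==> (z.1 == i)) && ((q %| d) ==> (z.2 == j)))]
  else S u.
exists (r d); apply: (IHds _ T) => [u|u z].
  by rewrite /strike /T; case: ifP => // _; apply: fits_hit.
have [ptM ptp ptq] := ptE u z.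
rewrite /T => Tz; have Sz : z \in S u.
  by move: Tz; case: ifP => //; rewrite inE => _ /andP[].
have [d' ] := covS u z Sz; rewrite inE => /predU1P[->|]; last by exists d'.
have down e : e %| d -> pt u z = r d %[mod d] -> pt u z = r d %[mod e].
  by move=> e_d eq_d; rewrite -(modn_dvdm (pt u z) e_d) eq_d modn_dvdm.
move=> eq_d; move: Tz; rewrite ifT; last first.
  rewrite -(down _ (dvdn_gcdl _ _) eq_d) -(modn_dvdm u (dvdn_gcdr _ _)) -ptM.
  by rewrite modn_dvdm ?dvdn_gcdr.
rewrite inE Sz /=; case/negP; apply/andP; split; apply/implyP=> e_d;
  apply/eqP/val_inj => /=.
- by rewrite -(down _ e_d eq_d) ptp modn_small.
- by rewrite -(down _ e_d eq_d) ptq modn_small.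
Qed.

(** The moduli [p] and [q], when at least 5, strike one column or row of every grid; the starting
    cell already accounts for them, so [ds] may omit them. *)
Lemma covered_solvable (M p q : nat) (ds : seq nat) :
  0 < p -> 0 < q -> coprime M p -> coprime M q -> coprime p q ->
  (forall d, d %| M * p * q -> 5 <= d -> [|| d == p, d == q | d \in ds]) ->
  covered (M * p * q) ->
  solvable (map (entry M p q) ds) (fun=> (p - (5 <= p), q - (5 <= q), 0)).
Proof.
move=> p_gt0 q_gt0 coMp coMq copq dsP [r cov].
(* The point above [u] in column [z.1] and row [z.2], by two uses of the Chinese remainder
   theorem. *)
pose pt u (z : 'I_p * 'I_q) := chinese (M * p) q (chinese M p u z.1) z.2.
have ptE u z : [/\ pt u z = u %[mod M], pt u z = z.1 %[mod p] & pt u z = z.2 %[mod q]].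
  have coMpq : coprime (M * p) q by rewrite coprimeMl coMq.
  have ptMp := chinese_modl coMpq (chinese M p u z.1) z.2.
  split; last exact: chinese_modr.
  - rewrite -(modn_dvdm _ (dvdn_mulr p (dvdnn M))) ptMp.
    by rewrite modn_dvdm ?dvdn_mulr ?chinese_modl.
  - rewrite -(modn_dvdm _ (dvdn_mull M (dvdnn p))) ptMp.
    by rewrite modn_dvdm ?dvdn_mull ?chinese_modr.
pose live n := [set i : 'I_n | ~~ ((5 <= n) && (i == r n %% n :> nat))].
have card_live n : 0 < n -> n - (5 <= n) <= #|live n|.
  move=> n_gt0; case: (leqP 5 n) => le5n.
    rewrite -[X in X - _]card_ord -cardsT (cardsD1 (Ordinal (ltn_pmod (r n) n_gt0))).
    rewrite inE addKn.
    by apply/subset_leq_card/subsetP=> i; rewrite !inE le5n andbT.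
  rewrite subn0 -[X in X <= _]card_ord -cardsT.
  by apply/subset_leq_card/subsetP=> i; rewrite !inE leqNgt le5n.
apply: (@solvable_fits _ _ _ r pt _ _ (fun=> setX (live p) (live q))) => // u.
  exists (live p), (live q), set0; split; rewrite ?card_live ?cards0 //=.
  by rewrite setD0.
case=> i j; rewrite !inE /= => /andP[live_i live_j].
have [d [dN le5d eq_d]] := cov (pt u (i, j)); exists d => //.
have [_ ptp ptq] := ptE u (i, j).
case/or3P: (dsP d dN le5d) => // /eqP def_d; rewrite def_d in le5d eq_d.
- by move: live_i; rewrite le5d -eq_d ptp modn_small ?eqxx.
- by move: live_j; rewrite le5d -eq_d ptq modn_small ?eqxx.
Qed.

(* The first two progressions have coprime e's, so a translation of Z/M moves
   them to residue 0. *)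
Definition certified (M p q : nat) (prefix : seq nat) : bool :=
  let ds := prefix ++
    [seq d <- divisors (M * p * q) | [&& 5 <= d, d != p, d != q & d \notin prefix]] in
  [&& 0 < M, 0 < p, 0 < q, coprime M p, coprime M q, coprime p q &
  if map (entry M p q) ds is (e1, k1) :: (e2, k2) :: L then
    let s0 := nseq M (p - (5 <= p), q - (5 <= q), 0) in
    let s := strikes e2 k2 0 (strikes e1 k1 0 s0) in
    coprime e1 e2 && refute (size L) (refresh s [seq (x, 0) | x <- L]) s
  else false].

Lemma certifiedP (M p q : nat) (prefix : seq nat) :
  certified M p q prefix -> ~ covered (M * p * q).
Proof.
rewrite /certified; set ds := prefix ++ _.
case/and5P=> M_gt0 p_gt0 q_gt0 coMp /and3P[coMq copq cert] cov.
have dsP d : d %| M * p * q -> 5 <= d -> [|| d == p, d == q | d \in ds].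
  move=> dN le5d; rewrite mem_cat mem_filter le5d.
  rewrite -dvdn_divisors ?muln_gt0 ?M_gt0 ?p_gt0 // dN.
  by case: (d == p) (d == q) (d \in prefix) => [] [] [].
have := covered_solvable p_gt0 q_gt0 coMp coMq copq dsP cov.
have entryP x : x \in map (entry M p q) ds -> 0 < x.1 /\ x.1 %| M.
  by case/mapP=> d _ ->; rewrite gcdn_gt0 M_gt0 orbT dvdn_gcdr.
case: map entryP cert => [|[e1 k1] [|[e2 k2] L]] //= entryP /andP[co12 ref].
have gt0L : all (fun y => 0 < y.1) [:: (e1, k1), (e2, k2) & L].
  by apply/allP=> y /entryP[].
move/(solvable_normalize co12 gt0L).
set s0 := nseq _ _ in ref; set s := strikes _ _ _ _ in ref.
have [[/= e1_gt0 e1M] [/= e2_gt0 e2M]] :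
  (0 < e1 /\ e1 %| M) /\ (0 < e2 /\ e2 %| M).
  by split; [apply: (entryP (e1, k1)) | apply: (entryP (e2, k2))];
    rewrite !inE eqxx ?orbT.
have size_s : size s = M by rewrite !size_strikes size_nseq.
have Ldvd : {in [seq (x, 0) | x <- L], forall x, 0 < x.1.1 /\ x.1.1 %| size s}.
  by move=> y /mapP[x Lx ->]; rewrite size_s; apply: entryP; rewrite !inE Lx !orbT.
move=> sol; apply: (refuteP _ _ _ ref); rewrite ?size_s //.
- by move=> y; rewrite refreshE => /mapP[x /Ldvd ? ->]; rewrite -size_s.
- by rewrite -size_s; apply: refresh_cap.
rewrite unzip1_refresh /unzip1 -map_comp map_id.
apply: solvable_ext sol => u; rewrite periodic_strikes ?size_strikes ?size_nseq //.
rewrite /strike; congr (if _ then hit _ _ else _).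
all: rewrite periodic_strikes ?size_nseq // /strike.
all: by rewrite /periodic size_nseq nth_nseq ltn_pmod.
Qed.

(** * Density bound and candidates below 1440 *)

Lemma card_class (n d r : nat) :
  0 < d -> \sum_(x < n * d | x == r %[mod d]) 1 = n.
Proof.
move=> d_gt0; have lt_rd := ltn_pmod r d_gt0.
rewrite -(big_mkord (fun x => x == r %[mod d]) (fun=> 1)).
elim: n => [|n IHn]; first by rewrite big_geq.
by rewrite (sum_class_recl _ (fun=> 1)) // IHn.
Qed.

(** A union bound over the classes, by exchanging the sums over [d] and [x]. *)
Lemma covered_density (N : nat) :
  covered N -> N <= sumn [seq N %/ d | d <- divisors N & 5 <= d].
Proof.
case: (posnP N) => [-> // | N_gt0] [r cov].
rewrite -[X in X <= _]card_ord -sum1_card sumnE big_map.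
rewrite (eq_big_seq (fun d => \sum_(x < N | x == r d %[mod d]) 1)) => [|d]; last first.
  rewrite mem_filter -dvdn_divisors // => /andP[le5d dN].
  by have := card_class (N %/ d) (r d) (leq_trans _ le5d); rewrite divnK // => ->.
rewrite (eq_bigr (fun d => \sum_(x < N) (x == r d %[mod d]))) => [|d _]; last first.
  by rewrite big_mkcond; apply: eq_bigr => x _; case: eqP.
rewrite exchange_big /=; apply: leq_sum => x _.
have [d [dN le5d /eqP xr]] := cov x.
by rewrite (big_rem d) ?mem_filter ?le5d -?dvdn_divisors //= xr.
Qed.

Lemma covered_dvd (N N' : nat) : N %| N' -> covered N -> covered N'.
Proof.
move=> NN' [r cov]; exists r => x; have [d [dN le5d eq_d]] := cov x.
by exists d; rewrite (dvdn_trans dN NN').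
Qed.

(* The prefixes, which order the moduli for branching, were found by local
   search; p = 1 or q = 1 makes that side of the grid trivial. *)
Definition branchings : seq (nat * nat * nat * seq nat) :=
  [:: (144, 5, 1, [:: 16; 9; 10; 15; 8; 6; 12; 20; 30; 60; 24]);
      (24, 5, 7, [:: 8; 15; 14; 10; 6]);
      (900, 1, 1, [:: 5; 6]);
      (192, 5, 1, [:: 64; 15]);
      (18, 5, 11, [:: 9; 10]);
      (150, 7, 1, [:: 5; 6]);
      (216, 5, 1, [:: 8; 27; 10; 15; 6; 9; 12; 18]);
      (400, 3, 1, [:: 16; 5]);
      (36, 5, 7, [:: 9; 20; 14; 10; 15; 6; 12; 21]);
      (24, 5, 11, [:: 8; 15])].

Lemma branchings_certified :
  all (fun b => let: (M, p, q, prefix) := b in certified M p q prefix) branchings.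
Proof. by vm_compute. Qed.

Definition exceptional : seq nat :=
  [seq let: (M, p, q, _) := b in M * p * q | b <- branchings].

Lemma exceptional_not_covered (N : nat) : N \in exceptional -> ~ covered N.
Proof.
case/mapP=> -[[[M p] q] prefix] /(allP branchings_certified) cert ->.
exact: certifiedP cert.
Qed.

Lemma density_or_exceptional (N : nat) :
  0 < N < 1440 -> 5 %| N ->
  sumn [seq N %/ d | d <- divisors N & 5 <= d] < N \/
  exists2 N', N' \in exceptional & N %| N'.
Proof.
move=> /andP[N_gt0 ltN] /dvdnP[n defN]; rewrite {N}defN in N_gt0 ltN *.
(* The range ends at 287 because [288 * 5 = 1440]. Some values, such as 360, pass the density test
   but properly divide an exceptional one. *)
have : all (fun n => 
    if sumn [seq n * 5 %/ d | d <- divisors (n * 5) & 5 <= d] < n * 5 then true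
    else has (dvdn (n * 5)) exceptional) (iota 1 287) by vm_compute.
move/allP/(_ n); rewrite mem_iota => /(_ ltac:(lia)).
by case: ifP => [|_ /hasP[N' N'x NN']]; [left | right; exists N'].
Qed.

(** * From covering systems to residue functions, and the conclusion *)

Lemma covering_covered (n : nat) (a : 'I_n -> int) (m : 'I_n -> nat) :
  covering_system a m -> (forall i j : 'I_n, i <> j -> m i <> m j) ->
  (forall i, 5 <= m i) -> covered (\big[lcmn/1]_(i < n) m i).
Proof.
move=> [m_gt0 cov] dist le5m.
(* Distinct moduli make the index picked for [d] the only one. A [d] that is no modulus gets residue
   0, an extra class that does no harm. *)
exists (fun d => if [pick i | m i == d] is Some i then `|(a i %% m i)%Z|%N else 0).
move=> x; have [i [k def_x]] := cov x; exists (m i); split=> //.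
  exact: (biglcmn_sup i).
case: pickP => [j /eqP mji | /(_ i)/eqP//].
have {j mji} -> : j = i by apply/eqP; case: (j =P i) => // /dist.
have : (x%:Z %% m i = a i %% m i)%Z by rewrite def_x GRing.addrC modzMDl.
rewrite modz_nat => <-.
by rewrite absz_nat modn_mod.
Qed.

Theorem theorem3 (n : nat) (a : 'I_n -> int) (m : 'I_n -> nat)
  (hcov : covering_system a m)
  (hdistinct : forall i j : 'I_n, i <> j -> m i <> m j)
  (hmin : (exists i : 'I_n, m i = 5) /\ (forall i : 'I_n, 5 <= m i)) :
  1440 <= \big[lcmn/1]_(i < n) m i.
Proof.
case: hmin => [[i mi5] le5m].
have := covering_covered hcov hdistinct le5m.
have : 5 %| \big[lcmn/1]_(i < n) m i by rewrite -mi5 (biglcmn_sup i).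
have : 0 < \big[lcmn/1]_(i < n) m i.
  elim/big_ind: _ => // [u v|j _]; first by rewrite lcmn_gt0 => -> ->.
  by case: hcov.
set N := \big[_/_]_(_ < _) _ => N_gt0 N5 covN; rewrite leqNgt; apply/negP=> ltN.
have [|[N' N'x NN']] := density_or_exceptional (introT andP (conj N_gt0 ltN)) N5.
  by rewrite ltnNge covered_density.
exact: exceptional_not_covered N'x (covered_dvd NN' covN).
Qed.
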